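(* As formal power series in $q,y_1,y_2$, $$\sum_{r_1,r_2,r_3\ge 0}y_1^{r_1}y_2^{2r_3+r_2}\,\frac{q^{r_1^2+(r_2+r_3)^2+r_3^2-r_1(r_2+2r_3)}}{(q)_{r_1}(q)_{r_2}(q)_{r_3}}$$ $$=\sum_{n_1,n_2,n_3,n_4,n_5\ge 0}y_1^{n_1+n_2+n_4}y_2^{2n_1+2n_3+n_4+n_5}\,\frac{q^{n_1^2+n_2^2+(n_3+n_5)^2+n_4^2+n_3^2+(2n_3+n_5)n_1+n_4(n_1+n_2)+n_3n_4}}{(q)_{n_1}(q)_{n_2}(q)_{n_3}(q)_{n_4}(q)_{n_5}}.$$
   Context: Notation: $(q)_k=\prod_{i=1}^{k}(1-q^i)$ for $k\ge 0$, $(q)_0=1$. *)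

(* Defs.v *)
From HB Require Import structures.
From mathcomp Require Import all_boot all_order all_algebra.
From mathcomp Require Import boolp classical_sets functions cardinality fsbigop.

Set Implicit Arguments.
Unset Strict Implicit.
Unset Printing Implicit Defensive.

Import GRing.Theory.

Local Open Scope ring_scope.

Record fps (R : Type) := Fps { fps_coef : nat -> R }.

Lemma fpsP (R : Type) (f g : fps R) : fps_coef f =1 fps_coef g -> f = g.
Proof. by case: f g => f [g] /= /funext ->. Qed.

HB.instance Definition _ (R : Type) := gen_eqMixin (fps R).
HB.instance Definition _ (R : Type) := gen_choiceMixin (fps R).

Section FpsZmodule.
Variable R : zmodType.
Implicit Types f g h : fps R.

Definition fps_zero : fps R := Fps (fun=> 0).
Definition fps_opp f := Fps (fun n => - fps_coef f n).
Definition fps_add f g := Fps (fun n => fps_coef f n + fps_coef g n).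

Fact fps_addA : associative fps_add.
Proof. by move=> f g h; apply: fpsP => n /=; rewrite addrA. Qed.

Fact fps_addC : commutative fps_add.
Proof. by move=> f g; apply: fpsP => n /=; rewrite addrC. Qed.

Fact fps_add0 : left_id fps_zero fps_add.
Proof. by move=> f; apply: fpsP => n /=; rewrite add0r. Qed.

Fact fps_addN : left_inverse fps_zero fps_opp fps_add.
Proof. by move=> f; apply: fpsP => n /=; rewrite addNr. Qed.

HB.instance Definition _ :=
  GRing.isZmodule.Build (fps R) fps_addA fps_addC fps_add0 fps_addN.

End FpsZmodule.

Section FpsRing.
Variable R : comNzRingType.
Implicit Types f g h : fps R.

Definition fpsC (c : R) : fps R := Fps (fun n => if n == 0%N then c else 0).
Definition fpsX : fps R := Fps (fun n => (n == 1%N)%:R).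

Definition fps_mul f g : fps R :=
  Fps (fun n => \sum_(i < n.+1) fps_coef f i * fps_coef g (n - i)%N).

Let tr n f : {poly R} := \poly_(i < n.+1) fps_coef f i.

Let fps_mul_tr n k f g : (k <= n)%N ->
  fps_coef (fps_mul f g) k = (tr n f * tr n g)`_k.
Proof.
move=> kn; rewrite coefM; apply: eq_bigr => i _.
by rewrite !coef_poly !ltnS (leq_trans (leq_subr _ _) kn)
  (leq_trans _ kn) // -ltnS.
Qed.

Fact fps_mulA : associative fps_mul.
Proof.
move=> f g h; apply: fpsP => n.
transitivity ((tr n f * (tr n g * tr n h))`_n).
  rewrite coefM; apply: eq_bigr => i _.
  by rewrite (fps_mul_tr _ _ (leq_subr i n)) coef_poly ltn_ord.
rewrite mulrA coefM; apply: eq_bigr => i _.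
have le_in : (i <= n)%N by rewrite -ltnS.
by rewrite (fps_mul_tr _ _ le_in) coef_poly ltnS leq_subr.
Qed.

Fact fps_mulC : commutative fps_mul.
Proof.
by move=> f g; apply: fpsP => n; rewrite !(fps_mul_tr _ _ (leqnn n)) mulrC.
Qed.

Fact fps_mul1 : left_id (fpsC 1) fps_mul.
Proof.
move=> f; apply: fpsP => n /=; rewrite big_ord_recl /= mul1r subn0.
by rewrite big1 ?addr0 // => i _; rewrite mul0r.
Qed.

Fact fps_mulDl : left_distributive fps_mul +%R.
Proof.
move=> f g h; apply: fpsP => n /=; rewrite -big_split /=.
by apply: eq_bigr => i _; rewrite mulrDl.
Qed.

Fact fps_1neq0 : fpsC 1 != 0.
Proof.
apply/eqP => /(congr1 (fun f => fps_coef f 0)) /= /eqP.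
by rewrite (negPf (oner_neq0 R)).
Qed.

HB.instance Definition _ := GRing.Zmodule_isComNzRing.Build (fps R)
  fps_mulA fps_mulC fps_mul1 fps_mulDl fps_1neq0.

Lemma fps_coef0M f g : fps_coef (f * g) 0 = fps_coef f 0 * fps_coef g 0.
Proof. exact: big_ord1. Qed.

End FpsRing.

Section FpsUnitRing.
Variable R : comUnitRingType.
Implicit Types f g : fps R.

Definition fps_unit : {pred fps R} :=
  fun f => fps_coef f 0 \is a GRing.unit.

(* [fps_inv_seq f n] lists the first n coefficients of 1/f. *)
Fixpoint fps_inv_seq f n : seq R :=
  if n is n'.+1 then
    let s := fps_inv_seq f n' in
    rcons s ((fps_coef f 0)^-1 *
      ((n' == 0%N)%:R - \sum_(i < n') s`_i * fps_coef f (n' - i)))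
  else [::].

Definition fps_inv f : fps R :=
  if f \in fps_unit then Fps (fun n => (fps_inv_seq f n.+1)`_n) else f.

Let size_fps_inv_seq f n : size (fps_inv_seq f n) = n.
Proof. by elim: n => //= n IHn; rewrite size_rcons IHn. Qed.

Let nth_fps_inv_seq f n i : (i < n)%N ->
  (fps_inv_seq f n)`_i = (fps_inv_seq f i.+1)`_i.
Proof.
elim: n => // n IHn; rewrite ltnS leq_eqVlt => /predU1P[-> // | lt_in].
by rewrite -(IHn lt_in) {1}/fps_inv_seq -/fps_inv_seq nth_rcons
  size_fps_inv_seq lt_in.
Qed.

Fact fps_mulVf : {in fps_unit, left_inverse 1 fps_inv *%R}.
Proof.
move=> f Uf; apply: fpsP => n.
rewrite /fps_inv Uf [LHS]/= big_ord_recr /= subnn.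
rewrite nth_rcons size_fps_inv_seq ltnn eqxx mulrAC mulVr // mul1r.
under eq_bigr => i _.
  rewrite -[rcons _ _]/(fps_inv_seq f i.+1).
  rewrite -(nth_fps_inv_seq f (ltn_ord i)); over.
by rewrite addrC subrK; case: n.
Qed.

Fact fps_unitPl f g : g * f = 1 -> fps_unit f.
Proof.
move=> /(congr1 (fun h => fps_coef h 0)) /=; rewrite big_ord1 /= => gf1.
by apply/unitrPr; exists (fps_coef g 0); rewrite mulrC.
Qed.

Fact fps_inv_out : {in [predC fps_unit], fps_inv =1 id}.
Proof. by move=> f; rewrite inE /= /fps_inv => /negPf ->. Qed.

HB.instance Definition _ := GRing.ComNzRing_hasMulInverse.Build (fps R)
  fps_mulVf fps_unitPl fps_inv_out.

End FpsUnitRing.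

(* The ring Z[[q, y1, y2]], as Z[[q]][[y1]][[y2]]. *)
Notation fps3 := (fps (fps (fps int))).

Definition q : fps3 := fpsC (fpsC (fpsX int)).
Definition y1 : fps3 := fpsC (fpsX (fps int)).
Definition y2 : fps3 := fpsX (fps (fps int)).

(* The coefficient of q^k y1^a y2^b. *)
Definition coef3 (F : fps3) (k a b : nat) : int :=
  fps_coef (fps_coef (fps_coef F b) a) k.

(* Unconditional convergence for the coefficientwise topology (Z discrete). *)
Definition summable3 (I : choiceType) (F : I -> fps3) : Prop :=
  forall k a b : nat, finite_set [set i | coef3 (F i) k a b != 0]%classic.

(* A junk value when [F] is not summable. *)
Definition sum3 (I : choiceType) (F : I -> fps3) : fps3 :=
  Fps (fun b => Fps (fun a => Fps (fun k =>
    \sum_(i \in [set: I]%classic) coef3 (F i) k a b))).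

Definition qpoch (k : nat) : fps3 := \prod_(1 <= i < k.+1) (1 - q ^+ i).

Lemma qpoch_unit k : qpoch k \is a GRing.unit.
Proof.
rewrite /qpoch big_nat; elim/big_ind: _ => [|f g Uf Ug|i /andP[i_gt0 _]].
- exact: unitr1.
- by rewrite unitrM Uf.
have coefX0 j : (0 < j)%N ->
    fps_coef (fps_coef (fps_coef (q ^+ j) 0) 0) 0 = 0.
  by case: j => // j _; rewrite exprS !fps_coef0M mul0r.
change (fps_coef (fps_coef (fps_coef (1 - q ^+ i) 0) 0) 0 \is a GRing.unit).
by rewrite /= coefX0.
Qed.

(* So the truncated subtraction in the q-exponent of the triple sum is a
   genuine one. *)
Lemma lhs_exponent_ge0 (r1 r2 r3 : nat) :
  (r1 * (r2 + 2 * r3) <= r1 ^ 2 + (r2 + r3) ^ 2 + r3 ^ 2)%N.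
Proof.
have /= [H1 _] := nat_Cauchy r1 (r2 + r3); have /= [H2 _] := nat_Cauchy r1 r3.
rewrite -(leq_pmul2l (isT : 0 < 2)%N).
have -> : (r1 * (r2 + 2 * r3) = r1 * (r2 + r3) + r1 * r3)%N.
  by rewrite -mulnDr mul2n -addnn addnA.
rewrite mulnDr (leq_trans (leq_add H1 H2)) // addnACA addnn -mul2n.
by rewrite -addnA [leqRHS]mulnDr leq_add2l leq_pmull.
Qed.

(* Main.v *)
(* The q-Vandermonde (Durfee rectangle) identity
     1 / ((q)_m (q)_n) =
       sum_k q^((m - k)(n - k)) / ((q)_k (q)_(m - k) (q)_(n - k))
   trades a pair of summation variables (m, n) for a triple (k, m - k, n - k),
   adding m n to the quadratic form in the new variables.
   Fix the coefficient of y1^a y2^b. Applying the identity on the left to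
   (r1, r3), then to (what is left of r1, r2), then to (what is left of r1, what
   is left of r3), and on the right to (n4, n5) only, produces the same six-fold
   sum. *)
From HB Require Import structures.
Require Import Defs.
From mathcomp Require Import all_boot all_order all_algebra.
From mathcomp Require Import boolp classical_sets functions cardinality fsbigop.
From mathcomp Require Import ring zify.
Set Implicit Arguments.
Unset Strict Implicit.
Unset Printing Implicit Defensive.
Import GRing.Theory.
Local Open Scope ring_scope.

(** * The Durfee rectangle identity over a ring in which every [1 - x ^+ i] with [i > 0] is a
    unit *)

Section Durfee.
Variables (R : comUnitRingType) (x : R).
Hypothesis xU : forall i, (0 < i)%N -> 1 - x ^+ i \is a GRing.unit.

Definition qfact n := \prod_(1 <= i < n.+1) (1 - x ^+ i).
Let u n := (qfact n)^-1.

Let u0 : u 0 = 1.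
Proof. by rewrite /u /qfact big_geq ?invr1. Qed.

Lemma qfact_unit n : qfact n \is a GRing.unit.
Proof.
rewrite /qfact big_nat; elim/big_ind: _ => [|y z yU zU|i /andP[i_gt0 _]].
- exact: unitr1.
- by rewrite unitrM yU.
- exact: xU.
Qed.

Lemma qfactVS n : (1 - x ^+ n.+1) / qfact n.+1 = (qfact n)^-1.
Proof.
have -> : qfact n.+1 = qfact n * (1 - x ^+ n.+1) by apply: big_nat_recr.
by rewrite invrM ?qfact_unit ?xU // mulVKr ?xU.
Qed.

Let uS n : (1 - x ^+ n.+1) * u n.+1 = u n := qfactVS n.

(* [1 / (x)_(n - k)], read as [0] when [n < k]. *)
Let w n k := if (k <= n)%N then u (n - k) else 0.

(** The recursion for [u], free of side conditions: at [n = k] the factor [1 - x ^+ 0] vanishes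
    together with [w n k.+1], and for [n < k] both sides are zero. *)
Let wS n k : (1 - x ^+ (n - k)) * w n k = w n k.+1.
Proof.
rewrite /w; case: ltngtP => [lt_kn|_|->]; rewrite ?mulr0 //.
- by rewrite -(uS (n - k.+1)) -subSn // subSS.
- by rewrite subnn subrr mul0r.
Qed.

(** Induction on [m], after cancelling the unit [1 - x ^+ m.+1]. Any bound [N > m] works because
    [w m k] vanishes for [k > m]. *)
Lemma durfee_rectangle N m n : (m < N)%N ->
  u m * u n = \sum_(k < N) x ^+ ((m - k) * (n - k)) * u k * w m k * w n k.
Proof.
case: N => // N; elim: m => [|m IHm] lt_mN.
  rewrite big_ord_recl big1 /w => [|k _]; last by rewrite mulr0 mul0r.
  by rewrite /= !subn0 mul0n u0 !mul1r addr0.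
apply: (mulrI (xU (ltn0Sn m))); rewrite mulrA uS IHm 1?ltnW //.
(* The factor is split as 1 - x^(m+1) = (1 - x^(m+1-k)) + x^(m+1-k) (1 - x^k). The first part lowers
   [w m.+1 k] to [w m k], giving [b]; the second, kept in [c], lowers [u k] to [u (k - 1)]. *)
pose b k := x ^+ ((m - k) * (n - k)) * u k * w m k.
pose c k := x ^+ (m.+1 - k + (m.+1 - k) * (n - k)) *
  ((1 - x ^+ k) * u k) * w m.+1 k * w n k.
transitivity (\sum_(k < N.+1) (b k * (x ^+ (n - k) * w n k) + c k)); last first.
  rewrite mulr_sumr; apply: eq_bigr => k _; rewrite /b /c.
  have [le_km|lt_mk|->] := ltngtP k m.+1.
  - have -> : w m k = (1 - x ^+ (m.+1 - k)) * w m.+1 k by rewrite wS.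
    have -> : ((m.+1 - k) * (n - k) = (m - k) * (n - k) + (n - k))%N.
      by rewrite subSn // mulSn addnC.
    have -> : x ^+ m.+1 = x ^+ (m.+1 - k) * x ^+ k.
      by rewrite -exprD subnK // ltnW.
    rewrite !exprD; ring.
  - have [-> ->] : w m k = 0 /\ w m.+1 k = 0.
      by rewrite /w !ifF //; apply/negbTE; rewrite -ltnNge // ltnW.
    ring.
  - rewrite /w ltnn leqnn subnn !mul0n add0n expr0. ring.
(* [c 0] vanishes because of its factor 1 - x^0, so the sum of [c] can be shifted by one and
   expressed through [b]. *)
rewrite big_split /= [X in _ = _ + X]big_ord_recl {1}/c.
rewrite expr0 subrr mul0r mulr0 !mul0r add0r.
have -> : \sum_(i < N) c (lift ord0 i) = \sum_(k < N.+1) b k * w n k.+1.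
  have wmN : w m N = 0 by rewrite /w ifF //; apply/negbTE; rewrite -ltnNge.
  rewrite big_ord_recr /= [b N]/b wmN mulr0 mul0r addr0.
  apply: eq_bigr => k _; rewrite /c /= /bump leq0n add1n uS /b !subSS.
  have -> : w m.+1 k.+1 = w m k by [].
  rewrite {2 4}/w; case: ifP => [lt_kn|]; last by rewrite !mulr0.
  by rewrite -mulnS -subSn // subSS.
(* By [wS], x^(n-k) [w n k] + [w n k.+1] = [w n k], which restores the induction hypothesis. *)
rewrite -big_split; apply: eq_bigr => k _ /=; rewrite -wS /b; ring.
Qed.

(** The Durfee identity as a change of variables under a weight [A]: the old pair becomes
    [(m + k, n + k)]. Since [A] vanishes outside the box of side [N], all three new indices may run
    over the full range below [N]. *)
Lemma sum_durfee N (A : nat -> nat -> R) :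
    (forall m n, (N <= m)%N || (N <= n)%N -> A m n = 0) ->
  \sum_(m < N) \sum_(n < N) A m n * (u m * u n) =
  \sum_(k < N) \sum_(m < N) \sum_(n < N)
     A (m + k)%N (n + k)%N * x ^+ (m * n) * (u k * u m * u n).
Proof.
move=> A0.
(* [w m k] removes the terms with [m < k]; after the shift by [k], the terms added to fill the range
   have [m + k >= N], where [G] is zero. *)
have shift k (G : nat -> R) : (k < N)%N -> (forall m, (N <= m)%N -> G m = 0) ->
    \sum_(m < N) G m * w m k = \sum_(m < N) G (m + k)%N * u m.
  move=> ltkN G0; rewrite -!(big_mkord xpredT (fun m => G m * w m k)).
  rewrite (big_cat_nat (n := k)) ?(ltnW ltkN) //= big1_seq ?add0r; last first.
    move=> i /andP[_]; rewrite mem_index_iota /w => /andP[_] H.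
    by rewrite leqNgt H mulr0.
  rewrite -{1}(add0n k) big_addn big_mkord.
  rewrite (eq_bigr (fun m : 'I__ => G (m + k)%N * u m)); last first.
    by move=> i _; rewrite /w leq_addl addnK.
  rewrite (big_ord_widen _ (fun m => G (m + k)%N * u m) (leq_subr k N)).
  rewrite big_mkcond; apply: eq_bigr => i _; case: ifP => // H.
  by rewrite G0 ?mul0r //; lia.
pose B k m n := A m n * x ^+ ((m - k) * (n - k)) * u k.
transitivity (\sum_(k < N) \sum_(m < N) (\sum_(n < N) B k m n * w n k) * w m k).
  rewrite [RHS]exchange_big; apply: eq_bigr => m _.
  under [RHS]eq_bigr do rewrite mulr_suml.
  rewrite [RHS]exchange_big; apply: eq_bigr => n _ /=.
  rewrite (durfee_rectangle n (ltn_ord m)) mulr_sumr.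
  apply: eq_bigr => k _; rewrite /B; ring.
apply: eq_bigr => k _.
rewrite (shift k (fun m => \sum_(n < N) B k m n * w n k)) //; last first.
  by move=> m leNm; apply: big1 => n _; rewrite /B A0 ?leNm // !mul0r.
apply: eq_bigr => m _.
rewrite (shift k (B k (m + k)%N)) //; last first.
  by move=> n leNn; rewrite /B A0 ?leNn ?orbT // !mul0r.
rewrite mulr_suml; apply: eq_bigr => n _.
rewrite /B !addnK; ring.
Qed.

(** * Equality of the triple and quintuple sums, one coefficient at a time *)

Variable N : nat.
Local Notation "'S' i , E" := (\sum_(i < N) E)
  (at level 41, i name, right associativity, E at level 41).

(** Used to bring [n2] and [n3] outermost, leaving [p], [n4], [n5] inside in the order that
    [sum_durfee] produces. *)
Let exchange_pairs (F : nat -> nat -> nat -> nat -> nat -> R) :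
  S i, S j, S k, S l, S m, F i j k l m = S l, S m, S k, S i, S j, F i j k l m.
Proof.
rewrite (pair_bigA _ (fun i j : 'I_N => S k, S l, S m, F i j k l m)) /=.
under eq_bigr do rewrite exchange_big.
rewrite exchange_big; apply: eq_bigr => l _ /=.
under eq_bigr do rewrite exchange_big.
rewrite exchange_big; apply: eq_bigr => m _ /=.
rewrite exchange_big; apply: eq_bigr => k _ /=.
by rewrite (pair_bigA _ (fun i j : 'I_N => F i j k l m)).
Qed.

(** The indicators select the monomial y1^a y2^b. They force every index to be at most [a] or at
    most [b], so truncation at [N] loses no term. *)
Lemma triple_sum_eq_quintuple_sum a b : (a < N)%N -> (b < N)%N ->
  \sum_(r1 < N) \sum_(r2 < N) \sum_(r3 < N)
    ((r1 == a :> nat) && (2 * r3 + r2 == b)%N)%:R *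
    x ^+ (r1 ^ 2 + (r2 + r3) ^ 2 + r3 ^ 2 - r1 * (r2 + 2 * r3)) *
    (u r1 * u r2 * u r3) =
  \sum_(n1 < N) \sum_(n2 < N) \sum_(n3 < N) \sum_(n4 < N) \sum_(n5 < N)
    ((n1 + n2 + n4 == a)%N && (2 * n1 + 2 * n3 + n4 + n5 == b)%N)%:R *
    x ^+ (n1 ^ 2 + n2 ^ 2 + (n3 + n5) ^ 2 + n4 ^ 2 + n3 ^ 2
           + (2 * n3 + n5) * n1 + n4 * (n1 + n2) + n3 * n4) *
    (u n1 * u n2 * u n3 * u n4 * u n5).
Proof.
move=> lt_aN lt_bN.
pose c (a' b' : nat) : R := ((a' == a) && (b' == b))%:R.
have c0 a' b' : (N <= a')%N || (N <= b')%N -> c a' b' = 0.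
  by rewrite /c => ?; have -> : (a' == a) && (b' == b) = false by lia.
pose eL r1 r2 r3 := (r1 ^ 2 + (r2 + r3) ^ 2 + r3 ^ 2 - r1 * (r2 + 2 * r3))%N.
pose eR n1 n2 n3 n4 n5 := (n1 ^ 2 + n2 ^ 2 + (n3 + n5) ^ 2 + n4 ^ 2 + n3 ^ 2
           + (2 * n3 + n5) * n1 + n4 * (n1 + n2) + n3 * n4)%N.
(* Agreement of the exponents. The three products on the left come from the three Durfee steps,
   extracting [n1], [n4] and [p] in turn; [n4 * n5] on the right comes from the single step
   extracting [p]. *)
have eLR p n1 n2 n3 n4 n5 :
  (eL (n2 + p + n4 + n1) (n5 + n4) (n3 + p + n1)
     + (n2 + p + n4) * (n3 + p) + (n2 + p) * n5 + n2 * n3 =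
   eR n1 n2 n3 (n4 + p) (n5 + p) + n4 * n5)%N.
  have := lhs_exponent_ge0 (n2 + p + n4 + n1) (n5 + n4) (n3 + p + n1).
  rewrite /eL; set Y := (_ * (_ + 2 * _))%N; set X := (_ + _ + _)%N => leYX.
  (* Adding back the subtracted term [Y], legitimate as [Y <= X], leaves a polynomial identity. *)
  apply: (@addIn Y); rewrite 3!{1}(addnAC _ _ Y) subnK // /X /Y /eR -!mulnn.
  ring.
(* The summand of the common six-fold sum. *)
pose F (n1 n4 n5 p n2 n3 : nat) :=
   c (n2 + p + n4 + n1)%N (2 * (n3 + p + n1) + (n5 + n4))%N *
   x ^+ (eL (n2 + p + n4 + n1) (n5 + n4) (n3 + p + n1)
     + (n2 + p + n4) * (n3 + p) + (n2 + p) * n5 + n2 * n3)%N *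
   (u p * u n1 * u n2 * u n3 * u n4 * u n5).
transitivity (S n1, S n4, S n5, S p, S n2, S n3, F n1 n4 n5 p n2 n3).
(* First step, on [(r1, r3)] with [r2] as a parameter; it extracts [n1]. *)
- pose A1 r2 r1 r3 : R := c r1 (2 * r3 + r2)%N * x ^+ eL r1 r2 r3 * u r2.
  transitivity (S r2, S r1, S r3, A1 r2 r1 r3 * (u r1 * u r3)).
    rewrite exchange_big; do 3 (apply: eq_bigr => ? _).
    rewrite -/(eL _ _ _) /A1 /c; ring.
  (* Second step, on the rest [m] of [r1] and on [r2]; it extracts [n4]. *)
  pose A2 n1 n3 m r2 : R := c (m + n1)%N (2 * (n3 + n1) + r2)%N *
    x ^+ (eL (m + n1) r2 (n3 + n1) + m * n3)%N * (u n1 * u n3).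
  transitivity (S n1, S n3, S m, S r2, A2 n1 n3 m r2 * (u m * u r2)).
    under eq_bigr => r2 _.
      rewrite (sum_durfee (A := A1 r2)); last first.
        by move=> m n H; rewrite /A1 c0 ?mul0r //; lia.
      over.
    rewrite exchange_big; apply: eq_bigr => n1 _ /=.
    under eq_bigr do rewrite exchange_big.
    rewrite exchange_big; apply: eq_bigr => n3 _ /=.
    rewrite exchange_big; do 2 (apply: eq_bigr => ? _).
    rewrite /A1 /A2 exprD; ring.
  apply: eq_bigr => n1 _.
  (* Third step, on the rests of [r1] and [r3]; it extracts [p]. *)
  pose A3 n4 n5 m n3 : R :=
    c (m + n4 + n1)%N (2 * (n3 + n1) + (n5 + n4))%N *
    x ^+ (eL (m + n4 + n1) (n5 + n4) (n3 + n1) + (m + n4) * n3 + m * n5)%N *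
    (u n1 * u n4 * u n5).
  transitivity (S n4, S n5, S m, S n3, A3 n4 n5 m n3 * (u m * u n3)).
    under eq_bigr => n3 _.
      rewrite (sum_durfee (A := A2 n1 n3)); last first.
        by move=> m n H; rewrite /A2 c0 ?mul0r //; lia.
      over.
    rewrite exchange_big; apply: eq_bigr => n4 _ /=.
    under eq_bigr do rewrite exchange_big.
    rewrite exchange_big; apply: eq_bigr => n5 _ /=.
    rewrite exchange_big; do 2 (apply: eq_bigr => ? _).
    rewrite /A2 /A3 [x ^+ (_ + _ * n5)]exprD; ring.
  apply: eq_bigr => n4 _; apply: eq_bigr => n5 _.
  rewrite (sum_durfee (A := A3 n4 n5)); last first.
    by move=> m n H; rewrite /A3 c0 ?mul0r //; lia.
  do 3 (apply: eq_bigr => ? _); rewrite /F /A3 [in RHS]exprD; ring.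
apply: eq_bigr => n1 _.
rewrite (exchange_pairs (F n1)).
apply: eq_bigr => n2 _; apply: eq_bigr => n3 _.
(* The only step on the quintuple side, on [(n4, n5)]. *)
pose A4 n4 n5 : R := c (n1 + n2 + n4)%N (2 * n1 + 2 * n3 + n4 + n5)%N *
  x ^+ eR n1 n2 n3 n4 n5 * (u n1 * u n2 * u n3).
transitivity (S n4, S n5, A4 n4 n5 * (u n4 * u n5)); last first.
  do 2 (apply: eq_bigr => ? _); rewrite -/(eR _ _ _ _ _) /A4 /c; ring.
rewrite (sum_durfee (A := A4)); last first.
  by move=> m n H; rewrite /A4 c0 ?mul0r //; lia.
apply: eq_bigr => p _; apply: eq_bigr => n4 _; apply: eq_bigr => n5 _.
rewrite /F /A4 eLR exprD.
have -> : (n2 + p + n4 + n1 = n1 + n2 + (n4 + p))%N by lia.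
have -> : (2 * (n3 + p + n1) + (n5 + n4) =
           2 * n1 + 2 * n3 + (n4 + p) + (n5 + p))%N by lia.
ring.
Qed.

End Durfee.

(** * Constants, monomials and their coefficients in iterated power series *)

Section Fps.
Variable R : comNzRingType.
Implicit Types (f g : fps R) (c d : R).

Lemma fps_coef_sum (I : Type) (r : seq I) (F : I -> fps R) n :
  fps_coef (\sum_(i <- r) F i) n = \sum_(i <- r) fps_coef (F i) n.
Proof. exact: (big_morph (fun f => fps_coef f n)). Qed.

Fact fpsC_zmod_morphism : zmod_morphism (@fpsC R).
Proof. by move=> c d; apply: fpsP => -[|n] //=; rewrite subr0. Qed.

Fact fpsC_monoid_morphism : monoid_morphism (@fpsC R).
Proof.
split=> // c d; apply: fpsP => -[|n]; rewrite /= ?big_ord1 //.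
rewrite big1 // => i _.
case: i => -[|i] /= _; by rewrite ?mul0r ?mulr0.
Qed.

HB.instance Definition _ :=
  GRing.isZmodMorphism.Build R (fps R) (@fpsC R) fpsC_zmod_morphism.
HB.instance Definition _ :=
  GRing.isMonoidMorphism.Build R (fps R) (@fpsC R) fpsC_monoid_morphism.

Lemma fps_coefXM f n :
  fps_coef (fpsX R * f) n = if n is n'.+1 then fps_coef f n' else 0.
Proof.
case: n => [|n] /=; first by rewrite big_ord1 mul0r.
rewrite 2!big_ord_recl big1 => [|i _]; last by rewrite /= mul0r.
by rewrite /= mul0r add0r addr0 mul1r /bump leq0n subSS subn0.
Qed.

Lemma fps_coefXnC m n c : fps_coef (fpsX R ^+ m * fpsC c) n = c *+ (n == m).
Proof.
elim: m n => [|m IHm] n; first by rewrite expr0 mul1r /=; case: eqP.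
by rewrite exprS -mulrA fps_coefXM; case: n.
Qed.

End Fps.

Local Notation p := (qfact (fpsX int)).

Lemma fpsX_unit i : (0 < i)%N -> 1 - fpsX int ^+ i \is a GRing.unit.
Proof.
case: i => // i _; change (fps_coef (1 - fpsX int ^+ i.+1) 0 \is a GRing.unit).
by rewrite exprS /= big_ord1 mul0r subr0.
Qed.

(** Places the q-factorials in the constant copy of Z[[q]], so that the Durfee section applies with
    [x] the variable of [fps int]. *)
Lemma qpochE k : qpoch k = fpsC (fpsC (p k)).
Proof.
rewrite /qpoch /qfact 2!rmorph_prod; apply: eq_bigr => i _.
by rewrite 2!rmorphB 2!rmorphXn.
Qed.

Local Lemma p_unit k : p k \is a GRing.unit.
Proof. exact: qfact_unit fpsX_unit k. Qed.

Lemma q_divE n (D : fps int) : D \is a GRing.unit ->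
  q ^+ n / fpsC (fpsC D) = fpsC (fpsC (fpsX int ^+ n / D)).
Proof.
move=> DU; have DCU : fpsC D \is a GRing.unit by apply: rmorph_unit.
by rewrite /q -2!rmorphXn -(rmorphV _ DCU) -(rmorphV _ DU) -2!rmorphM.
Qed.

Lemma coef_monomial m n (g : fps int) a b :
  fps_coef (fps_coef (y1 ^+ m * y2 ^+ n * fpsC (fpsC g)) b) a =
  ((m == a) && (n == b))%:R * g.
Proof.
rewrite /y1 /y2 -rmorphXn mulrAC mulrC -rmorphM fps_coefXnC.
case: (b == n) / eqP => [->|/eqP/negPf neq_bn]; last first.
  by rewrite mulr0n (eq_sym n) neq_bn andbF mul0r.
by rewrite mulr1n eqxx andbT fps_coefXnC (eq_sym a) mulr_natl.
Qed.

(** * Summability and coefficients of families of monomials in y1, y2 over Z[[q]] *)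

Section MonomialFamily.
Variables (I : choiceType) (al be : I -> nat) (g : I -> fps int).
Let F i := y1 ^+ al i * y2 ^+ be i * fpsC (fpsC (g i)).
Variables (J : nat -> finType) (e : forall n, J n -> I).
Hypothesis eI : forall n, injective (@e n).
Hypothesis eP : forall i n,
  (al i < n)%N -> (be i < n)%N -> exists j : J n, e j = i.

Let suppF n a b k i : (a < n)%N -> (b < n)%N -> coef3 (F i) k a b != 0 ->
  exists j : J n, e j = i.
Proof.
move=> lt_an lt_bn; rewrite /coef3 coef_monomial.
case: andP => [[/eqP al_a /eqP be_b] _|_]; last by rewrite mulr0n mul0r eqxx.
by apply: eP; rewrite ?al_a ?be_b.
Qed.

(** Only indices with exponents exactly [(a, b)] contribute, and for [n > a, b] these lie in the
    image of the finite type [J n]. *)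
Lemma summable3_monomial : summable3 F.
Proof.
move=> k a b; set n := (a + b).+1.
have [lt_an lt_bn] : (a < n /\ b < n)%N by rewrite /n; lia.
apply: (@sub_finite_set _ _ [set` [seq e j | j : J n]]).
  by move=> i /(suppF lt_an lt_bn)[j <-]; apply/fintype.imageP; exists j.
exact: finite_seq.
Qed.

(** Replaces the sum over all of [I] by one over the finite box [J n]; injectivity of [e] ensures
    that no index is counted twice. *)
Lemma coef_sum3_monomial n a b : (a < n)%N -> (b < n)%N ->
  fps_coef (fps_coef (sum3 F) b) a =
  \sum_(j : J n) ((al (e j) == a) && (be (e j) == b))%:R * g (e j).
Proof.
move=> lt_an lt_bn; apply: fpsP => k; rewrite fps_coef_sum /=.
rewrite (fsbigE [seq e j | j : J n]) /=.
- rewrite big_map big_enum_cond; apply: eq_big => [j|j _].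
    by rewrite mem_setT.
  by rewrite /coef3 coef_monomial.
- by rewrite map_inj_uniq ?enum_uniq //; apply: eI.
- by [].
- move=> i _; apply: contraNeq => /(suppF lt_an lt_bn)[j <-].
  by apply/fintype.imageP; exists j.
Qed.

End MonomialFamily.

(** * Assembly: both series as monomial families, compared coefficientwise *)

Theorem theorem6p3 :
  let lhs := fun r : nat * nat * nat =>
    let: (r1, r2, r3) := r in
    y1 ^+ r1 * y2 ^+ (2 * r3 + r2) *
    (q ^+ (r1 ^ 2 + (r2 + r3) ^ 2 + r3 ^ 2 - r1 * (r2 + 2 * r3)) /
      (qpoch r1 * qpoch r2 * qpoch r3)) in
  let rhs := fun n : nat * nat * nat * nat * nat =>
    let: (n1, n2, n3, n4, n5) := n in
    y1 ^+ (n1 + n2 + n4) * y2 ^+ (2 * n1 + 2 * n3 + n4 + n5) *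
    (q ^+ (n1 ^ 2 + n2 ^ 2 + (n3 + n5) ^ 2 + n4 ^ 2 + n3 ^ 2
           + (2 * n3 + n5) * n1 + n4 * (n1 + n2) + n3 * n4) /
      (qpoch n1 * qpoch n2 * qpoch n3 * qpoch n4 * qpoch n5)) in
  [/\ summable3 lhs, summable3 rhs & sum3 lhs = sum3 rhs].
Proof.
move=> lhs rhs.
pose gl (r : nat * nat * nat) := let: (r1, r2, r3) := r in
  fpsX int ^+ (r1 ^ 2 + (r2 + r3) ^ 2 + r3 ^ 2 - r1 * (r2 + 2 * r3)) *
    (p r1 * p r2 * p r3)^-1.
pose gr (n : nat * nat * nat * nat * nat) := let: (n1, n2, n3, n4, n5) := n in
  fpsX int ^+ (n1 ^ 2 + n2 ^ 2 + (n3 + n5) ^ 2 + n4 ^ 2 + n3 ^ 2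
           + (2 * n3 + n5) * n1 + n4 * (n1 + n2) + n3 * n4) *
    (p n1 * p n2 * p n3 * p n4 * p n5)^-1.
pose al (r : nat * nat * nat) := r.1.1.
pose bl (r : nat * nat * nat) := (2 * r.2 + r.1.2)%N.
pose ar (n : nat * nat * nat * nat * nat) := (n.1.1.1.1 + n.1.1.1.2 + n.1.2)%N.
pose br (n : nat * nat * nat * nat * nat) :=
  (2 * n.1.1.1.1 + 2 * n.1.1.2 + n.1.2 + n.2)%N.
(* The finite boxes are cubes: each index occurs with positive weight in an exponent of y1 or y2, so
   it is below [n] when both exponents are. *)
pose el n (j : 'I_n * 'I_n * 'I_n) : nat * nat * nat :=
  (j.1.1 : nat, j.1.2 : nat, j.2 : nat).
pose er n (j : 'I_n * 'I_n * 'I_n * 'I_n * 'I_n) :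
    nat * nat * nat * nat * nat :=
  (j.1.1.1.1 : nat, j.1.1.1.2 : nat, j.1.1.2 : nat, j.1.2 : nat, j.2 : nat).
have lhsE : lhs = fun r => y1 ^+ al r * y2 ^+ bl r * fpsC (fpsC (gl r)).
  apply/funext => -[[r1 r2] r3]; rewrite /lhs /gl -q_divE ?unitrM ?p_unit //.
  by rewrite !rmorphM /= -!qpochE.
have rhsE : rhs = fun n => y1 ^+ ar n * y2 ^+ br n * fpsC (fpsC (gr n)).
  apply/funext => -[[[[n1 n2] n3] n4] n5].
  rewrite /rhs /gr -q_divE ?unitrM ?p_unit //.
  by rewrite !rmorphM /= -!qpochE.
have el_inj n : injective (@el n).
  by move=> [[i1 i2] i3] [[j1 j2] j3] [] /val_inj-> /val_inj-> /val_inj->.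
have er_inj n : injective (@er n).
  move=> [[[[i1 i2] i3] i4] i5] [[[[j1 j2] j3] j4] j5] [].
  by do 5 move=> /val_inj->.
have elP r n : (al r < n)%N -> (bl r < n)%N -> exists j, @el n j = r.
  move: r => [[r1 r2] r3]; rewrite /al /bl /= => h1 h2.
  have [h3 h4] : (r2 < n /\ r3 < n)%N by lia.
  by exists (Ordinal h1, Ordinal h3, Ordinal h4).
have erP r n : (ar r < n)%N -> (br r < n)%N -> exists j, @er n j = r.
  move: r => [[[[n1 n2] n3] n4] n5]; rewrite /ar /br /= => h1 h2.
  have [H1 [H2 [H3 [H4 H5]]]] :
    (n1 < n /\ n2 < n /\ n3 < n /\ n4 < n /\ n5 < n)%N by lia.
  by exists (Ordinal H1, Ordinal H2, Ordinal H3, Ordinal H4, Ordinal H5).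
rewrite lhsE rhsE; split.
- exact: summable3_monomial elP.
- exact: summable3_monomial erP.
apply: fpsP => b; apply: fpsP => a; set n := (a + b).+1.
have [lt_an lt_bn] : (a < n /\ b < n)%N by rewrite /n; lia.
rewrite (coef_sum3_monomial _ el_inj elP lt_an lt_bn).
rewrite (coef_sum3_monomial _ er_inj erP lt_an lt_bn).
have invM (f g : fps int) :
    f \is a GRing.unit -> g \is a GRing.unit -> (f * g)^-1 = f^-1 * g^-1.
  by move=> fU gU; rewrite invrM // mulrC.
have := triple_sum_eq_quintuple_sum fpsX_unit lt_an lt_bn.
(* Nested sums become sums over product types, matching the domains of [el] and [er]. *)
rewrite !pair_bigA => sumE.
apply: (eq_trans _ (eq_trans sumE _)); apply: eq_bigr.
- move=> [[i1 i2] i3] _.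
  by rewrite /gl /el /= !invM ?unitrM ?p_unit // mulrA.
- move=> [[[[i1 i2] i3] i4] i5] _.
  by rewrite /gr /er /= !invM ?unitrM ?p_unit // [in RHS]mulrA.
Qed.
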